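(* Let $p\in(0,1)$ and $b\in(0,\infty)$ be fixed, and let $q:(0,\infty)\to(0,1)$ be the function such that, for each $a>0$, $q(a)$ is the unique element of $(0,1)$ satisfying $$\int_0^{q(a)} t^{a-1}(1-t)^{b-1}\,dt = p\int_0^1 t^{a-1}(1-t)^{b-1}\,dt .$$ Then $q$ is strictly log-concave on $(0,\infty)$, i.e. $a\mapsto\log q(a)$ is strictly concave on $(0,\infty)$.
   Context: The value $q(a)$ is the $p$-quantile of the beta distribution with parameters $a,b$ (the inverse regularised incomplete beta function), regarded as a function of the first parameter $a$ with $p$ and $b$ fixed. *)

(* Defs.v *)
From HB Require Import structures.
From mathcomp Require Import all_boot all_order all_algebra.
From mathcomp Require Import all_classical all_reals all_analysis.
Set Implicit Arguments.
Unset Strict Implicit.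
Unset Printing Implicit Defensive.
Import Order.TTheory GRing.Theory Num.Theory.
Import numFieldNormedType.Exports.
Local Open Scope classical_set_scope.
Local Open Scope ring_scope.

(* The integral is taken over the open interval since the integrand is singular
   at 0 when a < 1 and at 1 when b < 1. *)
Definition incomplete_beta (R : realType) (a b x : R) : \bar R :=
  (\int[lebesgue_measure]_(t in `]0%R, x[)
     ((t `^ (a - 1) * (1 - t) `^ (b - 1))%R%:E))%E.

Definition is_beta_quantile (R : realType) (p a b x : R) : Prop :=
  0 < x < 1 /\
  incomplete_beta a b x = (p%:E * incomplete_beta a b 1)%E.

(* The library only has the non-strict notion [convex_function]. *)
Definition strictly_concave_on (R : realType) (D : interval R) (f : R -> R) :
    Prop :=
  {in D &, forall x y : R, x != y -> forall t : R, 0 < t < 1 ->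
    t * f x + (1 - t) * f y < f (t * x + (1 - t) * y)}.

Definition strictly_log_concave_on (R : realType) (D : interval R)
    (f : R -> R) : Prop :=
  strictly_concave_on D (fun x => ln (f x)).

(* Main.v *)
Require Import Defs.
From mathcomp Require Import all_boot all_order all_algebra.
From mathcomp Require Import all_classical all_reals all_analysis.
From mathcomp Require Import measurable_realfun ring lra.
Import Order.TTheory GRing.Theory Num.Theory.
Import numFieldNormedType.Exports.
Local Open Scope classical_set_scope.
Local Open Scope ring_scope.

(** Let T follow the beta distribution with parameters a and b, and put
    S = - ln T.  The density of S at s is proportional to
    exp(- a s) (1 - exp(- s))^(b - 1), so that S runs through an exponential
    family with parameter a, and y(a) = - ln q(a) is its upper p-quantile.
    The claim is that y is strictly convex.

    Differentiating P(S > y(a)) = p in a gives y'(a) = - K(a, y(a)), where K is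
    the Stein kernel of S: if f is the density of S and m its mean, then
    f(s) K(s) is the integral of (u - m) f(u) for u >= s.  Everything
    follows from two monotonicity properties: K increases with s
    ([stein_kernel_decr], stated below in the variable x = exp(- s)) and K
    decreases with a ([stein_kernel_decr_param]).  As y decreases in a, both
    effects make K(a, y(a)) decrease, hence y' increase.

    Monotonicity in s.  Let - r be the score f'/f.  Then K' = m - s + r K, and
    f K' is, up to sign, the integral of f(u) ((s - m) r(u) - r(s) (u - m))
    over u >= s or, if b > 1, equally over u <= s.  If b <= 1, then r is
    positive and nonincreasing in s and the sign is immediate.  If b > 1,
    then r is strictly concave in s ([odds_tangent_lt]); Jensen's inequality
    and E r(S) = 0 give r(m) > 0 ([neg_score_at_mean_gt0]: the mean exceeds
    the mode), and concavity then determines the sign on the side of s away from m.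

    Monotonicity in a.  For a < c, the derivative in s of the density at c
    multiplied by K(a, s) - K(c, s) is the same density times
    (m_a - m_c) - (c - a) K(a, s).  Since K(a, .) is monotone, that factor
    changes sign only once; a function that vanishes at both ends and is
    driven by such a factor has no zero in between ([unimodal_gt_endpoint]).

    The implicit function q is never differentiated.  Given a0 < a1, let X be
    the curve for which ln X is affine and which meets q at a0 and a1.  The
    probability V(c) = P_c(T <= X(c)) equals p at both ends, and its derivative
    is a positive multiple of slope - K(c, - ln X(c)), which changes sign only
    once.  The same unimodality lemma yields V(c) < p in between, that is
    X(c) < q(c).

    All integrals are kept in the variable t = exp(- s) on (0, 1).  They enter
    only through the moments, primitives of (- ln t)^k t^(a-1) (1-t)^(b-1),
    whose derivatives in the endpoint come from the fundamental theorem of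
    calculus, and in a from a second-order expansion ([moment_expansion]). *)

(** * Calculus on an interval *)

Lemma derive_gt0_lt (R : realType) (f df : R -> R) (u v : R) : u < v ->
  {within `[u, v], continuous f} ->
  (forall x, u < x < v -> is_derive x 1 f (df x)) ->
  (forall x, u < x < v -> 0 < df x) -> f u < f v.
Proof.
move=> uv cf fdf df0.
have [c cuv] : exists2 c, c \in `]u, v[%R & f v - f u = df c * (v - u).
  by apply: MVT cf => // x; rewrite in_itv/=; exact: fdf.
rewrite in_itv/= in cuv.
by rewrite -subr_gt0 => ->; rewrite mulr_gt0 ?subr_gt0// df0.
Qed.

Lemma derive_ge0_le (R : realType) (f df : R -> R) (u v : R) : u <= v ->
  {within `[u, v], continuous f} ->
  (forall x, u < x < v -> is_derive x 1 f (df x)) ->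
  (forall x, u < x < v -> 0 <= df x) -> f u <= f v.
Proof.
rewrite le_eqVlt => /predU1P[-> //|uv] cf fdf df0.
have [c cuv] : exists2 c, c \in `]u, v[%R & f v - f u = df c * (v - u).
  by apply: MVT cf => // x; rewrite in_itv/=; exact: fdf.
rewrite in_itv/= in cuv.
by rewrite -subr_ge0 => ->; rewrite mulr_ge0 ?subr_ge0 ?(ltW uv)// df0.
Qed.

(** The derivative of [phi] changes sign at most once, from positive to
    negative: a value at or below the common endpoint value would, by the mean
    value theorem on both sides of it, force a nonpositive derivative before a
    nonnegative one. *)
Lemma unimodal_gt_endpoint (R : realType) (phi k psi : R -> R) (u v : R) :
  {within `[u, v], continuous phi} ->
  (forall x, u < x < v -> is_derive x 1 phi (k x * psi x)) ->
  (forall x, u < x < v -> 0 < k x) ->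
  (forall x y, u < x -> x < y -> y < v -> psi y < psi x) ->
  phi u = phi v -> forall x, u < x < v -> phi u < phi x.
Proof.
move=> cphi dphi k0 psid uv x /andP[ux xv].
rewrite ltNge; apply/negP => le_xu.
have [||y yux ey] := MVT ux (f := phi) (df := fun x => k x * psi x).
- move=> z; rewrite in_itv/= => /andP[uz zx].
  by apply: dphi; rewrite uz (lt_trans zx).
- apply: continuous_subspaceW cphi.
  by apply: subset_itvl; rewrite bnd_simp ltW.
have [||z zxv ez] := MVT xv (f := phi) (df := fun x => k x * psi x).
- move=> z; rewrite in_itv/= => /andP[uz zx].
  by apply: dphi; rewrite zx (lt_trans ux).
- apply: continuous_subspaceW cphi.
  by apply: subset_itvr; rewrite bnd_simp ltW.
move: yux zxv; rewrite !in_itv/= => /andP[uy yx] /andP[xz zv].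
have yz := psid y z uy (lt_trans yx xz) zv.
have ky : 0 < k y by apply: k0; rewrite uy (lt_trans yx).
have kz : 0 < k z by apply: k0; rewrite zv (lt_trans ux).
have : k y * psi y * (x - u) <= 0 by rewrite -ey subr_le0.
rewrite pmulr_lle0 ?subr_gt0// pmulr_rle0// => psiy.
have : 0 <= k z * psi z * (v - x) by rewrite -ez subr_ge0 -uv.
rewrite pmulr_lge0 ?subr_gt0// pmulr_rge0// => psiz.
by have := lt_le_trans yz psiy; rewrite ltNge psiz.
Qed.

Section taylor.
Variable R : realType.
Implicit Types (a c x z C : R).

(** Both bounds come from [1 + z <= expR z], used at [z] and [- z]; the maximum
    makes the upper bound valid for either sign of [z]. *)
Lemma expRN_taylor2 z :
  0 <= expR (- z) - 1 + z <= z ^+ 2 * Num.max 1 (expR (- z)).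
Proof.
have h0 := expR_ge1Dx (- z); have h1 := expR_ge1Dx z.
have E0 := expR_gt0 (- z).
have h2 : expR (- z) * (1 + z) <= 1.
  by rewrite -ler_pdivlMl// expRN invrK mulr1.
apply/andP; split; first by lra.
have [z0|z0] := lerP 0 z.
  apply: (@le_trans _ _ (z ^+ 2)); last first.
    by rewrite ler_peMr ?sqr_ge0// le_max lexx.
  by nra.
apply: (@le_trans _ _ (z ^+ 2 * expR (- z))); first by nra.
by rewrite ler_wpM2l ?sqr_ge0// le_max lexx orbT.
Qed.

Lemma is_derive_quadratic (D : R -> R) a C : D a = 0 ->
  (\forall c \near a, `|D c| <= C * (c - a) ^+ 2) -> is_derive a 1 D 0.
Proof.
move=> Da nD.
have cvg0 : h^-1 *: ((D \o shift a) (h *: (1 : R)) - D a) @[h --> 0^'] -->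
    (0 : R).
  apply/cvgrPdist_le => /= e e0.
  rewrite Da.
  have C0 : 0 < `|C| + 1 by rewrite ltr_wpDl.
  near=> h; rewrite subr0 sub0r normrN normrM normfV.
  have h0 : h != 0 by near: h; exact: nbhs_dnbhs_neq.
  rewrite ler_pdivrMl ?normr_gt0//.
  have he : `|h| <= e / (`|C| + 1).
    near: h; apply: dnbhs0_le; exact: divr_gt0.
  have Dh : `|D (h + a)| <= C * (h + a - a) ^+ 2.
    near: h; apply: nbhs_dnbhs.
    have : (h + a) @[h --> (0 : R)] --> a.
      rewrite -[X in _ --> X]add0r; apply: cvgD; [exact: cvg_id|exact: cvg_cst].
    by move/(_ _ nD).
  rewrite /GRing.scale/= mulr1 (le_trans Dh)// addrK.
  have -> : h ^+ 2 = `|h| * `|h| by rewrite -normrM -expr2 ger0_norm ?sqr_ge0.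
  rewrite mulrCA ler_wpM2l//.
  apply: (@le_trans _ _ ((`|C| + 1) * `|h|)).
    by rewrite ler_wpM2r// (le_trans (ler_norm _))// lerDl.
  by rewrite mulrC -ler_pdivlMr.
apply: DeriveDef; first by apply/cvg_ex; exists 0.
exact/cvg_lim.
Unshelve. all: by end_near. Qed.

Lemma is_derive_shift a x : is_derive x 1 (fun c => c - a) 1.
Proof.
have h := is_deriveB (is_derive_id x (1 : R)) (is_derive_cst a x 1).
by apply: (is_derive_eq h); rewrite subr0.
Qed.

End taylor.

(** * Primitives on the unit interval *)

Section primitive.
Variable R : realType.
Notation mu := (@lebesgue_measure R).
Local Notation primitive f x := (parameterized_integral mu 0 x f).

Lemma primitive0 (f : R -> R) : primitive f 0 = 0.
Proof. by rewrite /parameterized_integral set_itv1 Rintegral_set1. Qed.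

Lemma integrable_sub01 (f : R -> R) (x : R) : x <= 1 ->
  mu.-integrable `[0, 1] (EFin \o f) -> mu.-integrable `[0, x] (EFin \o f).
Proof.
by move=> x1; apply: integrableS => //; apply: subset_itvl; rewrite bnd_simp.
Qed.

Lemma primitive_continuous (f : R -> R) :
  mu.-integrable `[0, 1] (EFin \o f) ->
  {within `[0, 1], continuous (fun x : R => primitive f x)}.
Proof. exact: parameterized_integral_continuous. Qed.

Lemma primitive_derive (f : R -> R) (x : R) :
  mu.-integrable `[0, 1] (EFin \o f) -> 0 < x < 1 ->
  {for x, continuous (f : R -> R)} ->
  is_derive x 1 (fun x : R => primitive f x) (f x).
Proof.
move=> fi /andP[x0 x1] cf.
have [df fE] := continuous_FTC1_closed x1 fi x0 cf.
by apply: DeriveDef; [exact: df|rewrite -derive1E; exact: fE].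
Qed.

(** Improper integrability at both endpoints: by the fundamental theorem the
    integrals over the compact intervals [[e n, 1 - e n]] stay below [C + C],
    and they converge monotonically to the integral over the open interval. *)
Lemma integrable_bounded_primitive (f F : R -> R) (C : R) :
  (forall x : R, 0 < x < 1 -> 0 <= f x) ->
  (forall x : R, 0 < x < 1 -> {for x, continuous (f : R -> R)}) ->
  (forall x : R, 0 < x < 1 -> is_derive x 1 F (f x)) ->
  (forall x : R, 0 < x < 1 -> `|F x| <= C) ->
  mu.-integrable `]0, 1[ (EFin \o f).
Proof.
move=> f0 cf dF FC.
(* Starting at 1/3 keeps every interval nondegenerate. *)
pose e n : R := n.+3%:R^-1.
have e0 n : 0 < e n by rewrite invr_gt0.
have e3 n : e n <= 3^-1 by rewrite lef_pV2 ?posrE// ler_nat.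
pose J n := [set` `[e n, 1 - e n]].
have JU : \bigcup_n J n = `]0, 1[%classic.
  apply/seteqP; split=> [x [n _]|x]; rewrite /J/= !in_itv/=.
    by have := e0 n; move=> ? /andP[? ?]; apply/andP; split; lra.
  move=> /andP[x0 x1].
  have xm : 0 < Num.min x (1 - x) by rewrite lt_min x0 subr_gt0.
  have [n hn] : exists n, e n <= Num.min x (1 - x).
    exists (Num.truncn (Num.min x (1 - x))^-1).
    rewrite /e invf_ple ?posrE// (le_trans (ltW (truncnS_gt _)))//.
    by rewrite ler_nat ltnS ltnW// ltnW.
  exists n => //; rewrite /J/= in_itv/=.
  by move: hn; rewrite le_min => /andP[h1 h2]; apply/andP; split; lra.
have Jin n x : J n x -> 0 < x < 1.
  move=> Jx; have : (\bigcup_n J n) x by exists n.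
  by rewrite JU /= in_itv.
have mJ n : measurable (J n) by exact: measurable_itv.
have cfJ n : {within J n, continuous f}.
  apply: continuous_in_subspaceT => x; rewrite inE => /Jin; exact: cf.
have mf : measurable_fun (`]0, 1[%classic : set R) f.
  apply: open_continuous_measurable_fun => // x; rewrite inE/= in_itv/=.
  exact: cf.
have mfJ n : measurable_fun (J n) f.
  by apply: measurable_funS mf => // x /Jin; rewrite /= in_itv.
have intJ n : (\int[mu]_(x in J n) (f x)%:E <= (C + C)%:E)%E.
  have ee : e n < 1 - e n by have := e3 n; lra.
  have inJ x : e n <= x <= 1 - e n -> 0 < x < 1.
    by move=> h; apply: (Jin n); rewrite /J/= in_itv.
  rewrite (@continuous_FTC2 _ f F)//.
  - rewrite -EFinB lee_fin.
    have h1 := FC (1 - e n) (inJ _ _); have h2 := FC (e n) (inJ _ _).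
    have {}h1 := h1 ltac:(by rewrite lexx ltW).
    have {}h2 := h2 ltac:(by rewrite lexx ltW).
    by move: h1 h2; rewrite !ler_norml => /andP[? ?] /andP[? ?]; lra.
  - exact: cfJ.
  - have dFx x : e n <= x <= 1 - e n -> derivable F x 1.
      by move=> /inJ /dF[].
    have cF x : e n <= x <= 1 - e n -> {for x, continuous F}.
      by move=> /dFx /derivable1_diffP/differentiable_continuous.
    split.
    + by move=> x; rewrite in_itv/= => /andP[? ?]; apply: dFx; rewrite !ltW.
    + by apply: cvg_at_right_filter; apply: cF; rewrite lexx ltW.
    + by apply: cvg_at_left_filter; apply: cF; rewrite lexx ltW.
  - move=> x; rewrite in_itv/= => /andP[? ?].
    have h : e n <= x <= 1 - e n by rewrite !ltW.
    by rewrite derive1E; have [_ ->] := dF _ (inJ _ h).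
apply/integrableP; split; first exact/measurable_EFinP.
apply: (@le_lt_trans _ _ (C + C)%:E); last exact: ltry.
have -> : (\int[mu]_(x in `]0%R, 1%R[) `|(EFin \o f) x| =
            \int[mu]_(x in `]0%R, 1%R[) (f x)%:E)%E.
  apply: eq_integral => x; rewrite inE/= in_itv/= => x01.
  by rewrite ger0_norm ?f0.
rewrite -JU.
have ndJ : nondecreasing_seq J.
  move=> n k nk; rewrite subsetEset /J; apply: subset_itv; rewrite bnd_simp.
    by rewrite lef_pV2 ?posrE// ler_nat.
  by rewrite lerD2l lerN2 lef_pV2 ?posrE// ler_nat.
have cvgJ : (\int[mu]_(x in J n) (f x)%:E @[n --> \oo] -->
             \int[mu]_(x in \bigcup_n J n) (f x)%:E)%E.
  apply: ge0_nondecreasing_set_cvg_integral => // [n|n x Jx].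
    by apply/measurable_EFinP; exact: mfJ.
  by rewrite lee_fin f0// (Jin n).
move/cvg_lim : (cvgJ) => <- //.
apply: lime_le; first by apply/cvg_ex; eexists; exact: cvgJ.
exact: nearW.
Unshelve. all: by end_near. Qed.

End primitive.

(** * The beta weight and its logarithmic moments *)

Section beta_weight.
Variable R : realType.
Notation mu := (@lebesgue_measure R).
Implicit Types (a b c x t u : R) (k : nat).

Lemma integrable_oo_cc (f : R -> R) (u v : R) :
  mu.-integrable (`]u, v[%classic : set R) (EFin \o f) ->
  mu.-integrable (`[u, v]%classic : set R) (EFin \o f).
Proof.
move=> /integrableP[mf fi]; apply/integrableP; split.
  exact: (@emeasurable_fun_itv_cc _ _ _ false true).
rewrite -(integral_itv_bndoo true false) in fi => //.
exact: measurableT_comp.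
Qed.

Definition beta_weight a b t := t `^ (a - 1) * (1 - t) `^ (b - 1).

Definition log_weight k a b t := (- ln t) ^+ k * beta_weight a b t.

Lemma beta_weight_gt0 a b t : 0 < t < 1 -> 0 < beta_weight a b t.
Proof. by move=> /andP[t0 t1]; rewrite mulr_gt0 ?powR_gt0 ?subr_gt0. Qed.

Lemma beta_weight_shift a b c t : 0 < t ->
  beta_weight c b t = t `^ (c - a) * beta_weight a b t.
Proof.
move=> t0; rewrite /beta_weight mulrA -powRD; last first.
  by apply/implyP => _; rewrite gt_eqF.
by congr (_ `^ _ * _); ring.
Qed.

Lemma powR_continuous_at c x : 0 < x -> {for x, continuous (fun t => t `^ c)}.
Proof.
move=> x0; apply/differentiable_continuous/derivable1_diffP.
by apply: derivable_powR; rewrite in_itv/= x0.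
Qed.

Lemma is_derive_powR_onem c x : x < 1 ->
  is_derive x 1 (fun t => (1 - t) `^ c) (- (c * (1 - x) `^ (c - 1))).
Proof.
move=> x1.
have h : is_derive (1 - x) 1 (fun t => t `^ c) (c * (1 - x) `^ (c - 1)).
  by apply: is_derive1_powR; rewrite subr_gt0.
have h1 : is_derive x 1 (fun t : R => 1 - t) (-1).
  have := is_deriveB (is_derive_cst (1 : R) x 1) (is_derive_id x 1).
  by rewrite sub0r.
have h2 := @is_derive1_comp _ (fun t => t `^ c) (fun t : R => 1 - t) x _ _ h h1.
by move: h2; rewrite mulrN1.
Qed.

Lemma powR_onem_continuous_at c x : x < 1 ->
  {for x, continuous (fun t => (1 - t) `^ c)}.
Proof.
move=> x1; apply/differentiable_continuous/derivable1_diffP.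
by have [] := is_derive_powR_onem c x x1.
Qed.

Lemma log_weight_continuous_at k a b x : 0 < x < 1 ->
  {for x, continuous (log_weight k a b)}.
Proof.
move=> /andP[x0 x1]; apply: continuousM.
  apply: (@continuous_comp _ _ _ (fun t => - ln t) (fun s => s ^+ k)).
    by apply: continuousN; exact: continuous_ln.
  exact: exprn_continuous.
apply: continuousM; first exact: powR_continuous_at.
exact: powR_onem_continuous_at.
Qed.

Lemma powR_half_le c u : 2^-1 <= u <= 1 -> u `^ c <= 2 `^ `|c|.
Proof.
move=> /andP[u2 u1]; have u0 : 0 < u by rewrite (lt_le_trans _ u2)// invr_gt0.
apply: (@le_trans _ _ (u `^ (- `|c|))).
  by apply: ger_powR; rewrite ?u0// lerNl ler_normr lexx orbT.
rewrite -mulN1r powRrM (powR_inv1 (ltW u0)).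
apply: (ge0_ler_powR (normr_ge0 c)); rewrite ?nnegrE ?invr_ge0 ?(ltW u0)//.
by rewrite invf_ple ?posrE.
Qed.

(** On each half of the interval only one of the two factors can be singular.
    The bound is a sum, rather than a product, of powers, which has an explicit
    bounded primitive. *)
Lemma beta_weight_le a b t : 0 < t < 1 -> beta_weight a b t <=
  (2 `^ `|a - 1| + 2 `^ `|b - 1|) * (t `^ (a - 1) + (1 - t) `^ (b - 1)).
Proof.
move=> /andP[t0 t1].
have pa := powR_ge0 2 `|a - 1|; have pb := powR_ge0 2 `|b - 1|.
have ta := powR_ge0 t (a - 1); have tb := powR_ge0 (1 - t) (b - 1).
have [t2|t2] := lerP t 2^-1.
- have h := powR_half_le (b - 1) (1 - t) ltac:(apply/andP; split; lra).
  apply: (@le_trans _ _ (2 `^ `|b - 1| * t `^ (a - 1))).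
    by rewrite /beta_weight [leLHS]mulrC ler_wpM2r.
  rewrite mulrDl !mulrDr; have := mulr_ge0 pa ta; have := mulr_ge0 pa tb.
  by have := mulr_ge0 pb tb; lra.
- have h := powR_half_le (a - 1) t ltac:(apply/andP; split; lra).
  apply: (@le_trans _ _ (2 `^ `|a - 1| * (1 - t) `^ (b - 1))).
    by rewrite /beta_weight ler_wpM2r.
  rewrite mulrDl !mulrDr; have := mulr_ge0 pa ta; have := mulr_ge0 pb ta.
  by have := mulr_ge0 pb tb; lra.
Qed.

Lemma integrable_beta_weight a b : 0 < a -> 0 < b ->
  mu.-integrable (`]0, 1[%classic : set R) (EFin \o beta_weight a b).
Proof.
move=> a0 b0.
pose C := 2 `^ `|a - 1| + 2 `^ `|b - 1| : R.
pose f t := C * (t `^ (a - 1) + (1 - t) `^ (b - 1)).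
have C0 : 0 <= C by rewrite addr_ge0 ?powR_ge0.
have fi : mu.-integrable (`]0, 1[%classic : set R) (EFin \o f).
  apply: (@integrable_bounded_primitive _ f
    (fun t => C * (a^-1 * t `^ a - b^-1 * (1 - t) `^ b))
    (C * (a^-1 + b^-1))).
  - by move=> x _; rewrite mulr_ge0// addr_ge0 ?powR_ge0.
  - move=> x /andP[x0 x1]; apply: continuousM; first exact: cvg_cst.
    apply: continuousD; first exact: powR_continuous_at.
    exact: powR_onem_continuous_at.
  - move=> x /andP[x0 x1].
    have h1 := is_derive1_powR a x0.
    have h2 := is_derive_powR_onem b x x1.
    apply: is_derive_eq.
    rewrite /f /GRing.scale/=.
    by field; rewrite !gt_eqF.
  - move=> x /andP[x0 x1].
    have p1 c (y : R) : 0 < c -> 0 < y < 1 -> 0 <= c^-1 * y `^ c <= c^-1.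
      move=> c0 /andP[y0 y1]; rewrite mulr_ge0 ?powR_ge0 ?invr_ge0 ?(ltW c0)//=.
      rewrite ler_piMr ?invr_ge0 ?(ltW c0)//.
      have := @ger_powR _ y; rewrite y0 (ltW y1) => /(_ isT 0 c (ltW c0)).
      by rewrite powRr0.
    have /andP[? ?] := p1 a x a0 ltac:(by rewrite x0).
    have /andP[? ?] := p1 b (1 - x) b0 ltac:(by apply/andP; split; lra).
    rewrite normrM (ger0_norm C0) ler_wpM2l// ler_norml.
    by apply/andP; split; lra.
apply: le_integrable fi => //.
  apply/measurable_EFinP; apply: open_continuous_measurable_fun => // x.
  rewrite inE/= in_itv/= => x01.
  suff <- : log_weight 0 a b = beta_weight a b.
    exact: log_weight_continuous_at.
  by apply/funext => t; rewrite /log_weight expr0 mul1r.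
move=> x /=; rewrite in_itv/= => x01; rewrite lee_fin.
rewrite ger0_norm; last exact/ltW/beta_weight_gt0.
by rewrite ger0_norm ?beta_weight_le// mulr_ge0// addr_ge0 ?powR_ge0.
Qed.

Lemma neg_ln_gt0 t : 0 < t < 1 -> 0 < - ln t.
Proof. by move=> t01; rewrite oppr_gt0 ln_lt0. Qed.

Lemma neg_ln_le_powR c t : 0 < c -> 0 < t -> - ln t <= c^-1 * t `^ (- c).
Proof.
move=> c0 t0; rewrite mulrC ler_pdivlMr// /powR gt_eqF//.
by have := expR_ge1Dx (- c * ln t); lra.
Qed.

(** A logarithm costs an arbitrarily small power of [t].  Paying
    [t `^ (- a / k.+1)] for each of the [k] logarithms leaves the exponent
    [a / k.+1 > 0]. *)
Lemma log_weight_le k a b t : 0 < a -> 0 < t < 1 ->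
  log_weight k a b t <= (a / k.+1%:R)^-1 ^+ k * beta_weight (a / k.+1%:R) b t.
Proof.
move=> a0 t01; have /andP[t0 t1] := t01.
set c := a / k.+1%:R; have c0 : 0 < c by rewrite divr_gt0.
rewrite /log_weight /beta_weight mulrA [leRHS]mulrA ler_wpM2r ?powR_ge0//.
apply: (@le_trans _ _ ((c^-1 * t `^ (- c)) ^+ k * t `^ (a - 1))).
  rewrite ler_wpM2r ?powR_ge0// lerXn2r ?nnegrE ?(ltW (neg_ln_gt0 _ t01))//.
    by rewrite mulr_ge0 ?invr_ge0 ?powR_ge0 ?(ltW c0).
  exact: neg_ln_le_powR.
rewrite exprMn -mulrA ler_wpM2l ?exprn_ge0 ?invr_ge0 ?(ltW c0)//.
rewrite -powR_mulrn ?powR_ge0// -powRrM -powRD; last first.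
  by apply/implyP => _; rewrite gt_eqF.
suff -> : - c * k%:R + (a - 1) = c - 1 by [].
by rewrite /c -natr1; field; rewrite natr1.
Qed.

Lemma integrable_log_weight k a b : 0 < a -> 0 < b ->
  mu.-integrable (`[0, 1]%classic : set R) (EFin \o log_weight k a b).
Proof.
move=> a0 b0; apply: integrable_oo_cc.
have c0 : 0 < a / k.+1%:R by rewrite divr_gt0.
have h := integrable_beta_weight _ _ c0 b0.
have {}h := @integrableZl _ _ _ mu _ _ ((a / k.+1%:R)^-1 ^+ k) _ h.
apply: le_integrable (h _) => //.
  apply/measurable_EFinP; apply: open_continuous_measurable_fun => // x.
  by rewrite inE/= in_itv/=; exact: log_weight_continuous_at.
move=> x /=; rewrite in_itv/= => x01; rewrite lee_fin.
rewrite ger0_norm; last first.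
  by apply: mulr_ge0; rewrite ?exprn_ge0 ?ltW ?neg_ln_gt0 ?beta_weight_gt0.
by rewrite (le_trans (log_weight_le _ _ _ _ a0 x01))// ler_norm.
Qed.

End beta_weight.

Section continuity.
Variable R : realType.
Implicit Types (c x t u : R).

Lemma within_continuousM (D : set R) (f g : R -> R) :
  {within D, continuous f} -> {within D, continuous g} ->
  {within D, continuous (fun t => f t * g t)}.
Proof. by move=> cf cg x; apply: continuousM; [exact: cf|exact: cg]. Qed.

Lemma within_continuousZ (D : set R) (f : R -> R) c :
  {within D, continuous f} -> {within D, continuous (fun t => c * f t)}.
Proof. by move=> cf x; apply: continuousM; [exact: cvg_cst|exact: cf]. Qed.

Lemma within01_sub (f : R -> R) u v : 0 <= u -> v <= 1 ->
  {within `[0, 1], continuous f} -> {within `[u, v], continuous f}.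
Proof.
move=> u0 v1; apply: continuous_subspaceW.
by apply: subset_itv; rewrite bnd_simp.
Qed.

Lemma powR_within_continuous c : 0 < c ->
  {within `[0, 1], continuous (fun t : R => t `^ c)}.
Proof.
move=> c0; apply/continuous_within_itvP => //; split.
- move=> x; rewrite in_itv/= => /andP[x0 _]; exact: powR_continuous_at.
- by rewrite powR0 ?gt_eqF//; exact: powR_cvg0.
- by apply: cvg_at_left_filter; exact: powR_continuous_at.
Qed.

Lemma powR_onem_within_continuous c : 0 < c ->
  {within `[0, 1], continuous (fun t : R => (1 - t) `^ c)}.
Proof.
move=> c0; apply/continuous_within_itvP => //; split.
- move=> x; rewrite in_itv/= => /andP[_ x1]; exact: powR_onem_continuous_at.
- by apply: cvg_at_right_filter; exact: powR_onem_continuous_at.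
- rewrite subrr powR0 ?gt_eqF//.
  apply: (@cvg_comp _ _ _ (fun t : R => 1 - t) (fun t => t `^ c) _ (0:R)^'+).
    move=> P [e/= e0 eP]; exists e => //= t/= te t1.
    apply: eP; last by rewrite subr_gt0.
    by move: te; rewrite /ball_/= sub0r normrN.
  exact: powR_cvg0.
Qed.

End continuity.

(** * Concavity of the score in logarithmic scale *)

Section concavity.
Variable R : realType.
Implicit Types (a b x t u m : R).

(** Strict convexity of [x / (1 - x)] as a function of [ln x], in tangent form:
    bounding [ln u - ln x] by [(u - x) / x] leaves a gap that is a positive
    multiple of [(u - x) ^+ 2]. *)
Lemma odds_tangent_lt x u : 0 < x < 1 -> 0 < u < 1 -> u != x ->
  x / (1 - x) ^+ 2 * (ln u - ln x) < u / (1 - u) - x / (1 - x).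
Proof.
move=> /andP[x0 x1] /andP[u0 u1] ux.
have hln : ln u - ln x <= (u - x) / x.
  rewrite -ln_div ?posrE// (_ : u / x = 1 + (u - x) / x); last first.
    by field; rewrite gt_eqF.
  by apply: le_ln1Dx; rewrite mulrBl divff ?gt_eqF// ltrBrDl subrr divr_gt0.
have x1' : 0 < 1 - x by rewrite subr_gt0.
have u1' : 0 < 1 - u by rewrite subr_gt0.
apply: (@le_lt_trans _ _ (x / (1 - x) ^+ 2 * ((u - x) / x))).
  by rewrite ler_wpM2l// divr_ge0 ?sqr_ge0// ltW.
rewrite -subr_gt0 (_ : _ - _ = (u - x) ^+ 2 / ((1 - u) * (1 - x) ^+ 2)).
  apply: divr_gt0; first by rewrite exprn_even_gt0//= subr_eq0.
  by rewrite mulr_gt0// exprn_gt0.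
by field; rewrite !gt_eqF.
Qed.

(** Minus the logarithmic derivative of the density of [- ln T], for [T]
    beta distributed, in the variable [x] = exp(- s). *)
Definition neg_score a b x := a - (b - 1) * (x / (1 - x)).

Lemma neg_score_tangent_lt a b x u : 1 < b ->
  0 < x < 1 -> 0 < u < 1 -> u != x ->
  neg_score a b u <
    neg_score a b x + (b - 1) * (x / (1 - x) ^+ 2) * (- ln u - - ln x).
Proof.
move=> b1 x01 u01 ux; have h := odds_tangent_lt _ _ x01 u01 ux.
have b1' : 0 < b - 1 by rewrite subr_gt0.
by move: h; rewrite -(ltr_pM2l b1') /neg_score; lra.
Qed.

Lemma neg_score_tangent_le a b x u : 1 < b -> 0 < x < 1 -> 0 < u < 1 ->
  neg_score a b u <=
    neg_score a b x + (b - 1) * (x / (1 - x) ^+ 2) * (- ln u - - ln x).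
Proof.
move=> b1 x01 u01; have [->|ux] := eqVneq u x.
  by rewrite subrr mulr0 addr0.
exact/ltW/neg_score_tangent_lt.
Qed.

End concavity.

(** * Moments, mean and Stein kernel *)

Section beta.
Variables (R : realType) (b : R).
Hypothesis b0 : 0 < b.
Notation mu := (@lebesgue_measure R).
Implicit Types (a c x y z t u : R) (k : nat).

Definition moment k a x : R :=
  parameterized_integral mu 0 x (log_weight R k a b).

(** The mean of [- ln T] for [T] beta distributed. *)
Definition mean a := moment 1 a 1 / moment 0 a 1.

Definition centered a x := moment 1 a x - mean a * moment 0 a x.

(** The density of [- ln T] at [- ln x], up to the normalising constant; the
    extra factor [x] with respect to [beta_weight] is the Jacobian. *)
Definition density_neg_ln a x := x `^ a * (1 - x) `^ (b - 1).

(** The Stein kernel of [- ln T] at [- ln x]; the normalising constants of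
    numerator and denominator cancel. *)
Definition stein_kernel a x := centered a x / density_neg_ln a x.

Local Notation w := (fun a => beta_weight R a b).
Local Notation r := (fun a => neg_score R a b).

Lemma moment0 k a : moment k a 0 = 0.
Proof. exact: primitive0. Qed.

Lemma moment_continuous k a : 0 < a ->
  {within `[0, 1], continuous (moment k a)}.
Proof.
by move=> a0; apply: primitive_continuous; exact: integrable_log_weight.
Qed.

Lemma moment_derive k a x : 0 < a -> 0 < x < 1 ->
  is_derive x 1 (moment k a) (log_weight R k a b x).
Proof.
move=> a0 x01; apply: primitive_derive => //.
  exact: integrable_log_weight.
exact: log_weight_continuous_at.
Qed.

Lemma moment_lt k a x y : 0 < a -> 0 <= x -> x < y -> y <= 1 ->
  moment k a x < moment k a y.
Proof.
move=> a0 x0 xy y1; apply: (derive_gt0_lt _ _ (log_weight R k a b)) => //.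
- by apply: within01_sub => //; exact: moment_continuous.
- by move=> z /andP[xz zy]; apply: moment_derive => //; apply/andP; split; lra.
- move=> z /andP[xz zy]; have z01 : 0 < z < 1 by apply/andP; split; lra.
  by rewrite mulr_gt0 ?beta_weight_gt0// exprn_gt0// neg_ln_gt0.
Qed.

Lemma moment_gt0 k a : 0 < a -> 0 < moment k a 1.
Proof. by move=> a0; rewrite -(moment0 k a) moment_lt. Qed.

Lemma mean_gt0 a : 0 < a -> 0 < mean a.
Proof. by move=> a0; rewrite divr_gt0 ?moment_gt0. Qed.

Lemma centered0 a : centered a 0 = 0.
Proof. by rewrite /centered !moment0 mulr0 subrr. Qed.

Lemma centered1 a : 0 < a -> centered a 1 = 0.
Proof.
by move=> a0; rewrite /centered /mean divfK ?subrr// gt_eqF// moment_gt0.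
Qed.

Lemma centered_continuous a : 0 < a ->
  {within `[0, 1], continuous (centered a)}.
Proof.
move=> a0; apply: within_continuousB; first exact: moment_continuous.
by apply: within_continuousZ; exact: moment_continuous.
Qed.

Lemma centered_derive a x : 0 < a -> 0 < x < 1 ->
  is_derive x 1 (centered a) (w a x * (- ln x - mean a)).
Proof.
move=> a0 x01.
have h0 := moment_derive 0 a x a0 x01; have h1 := moment_derive 1 a x a0 x01.
apply: is_derive_eq.
by rewrite /log_weight expr0 expr1 /GRing.scale/=; ring.
Qed.

Lemma centered_gt0 a x : 0 < a -> 0 < x < 1 -> 0 < centered a x.
Proof.
move=> a0 x01; rewrite -(centered0 a).
apply: (unimodal_gt_endpoint _ _ (w a) (fun x => - ln x - mean a) 0 1) => //.
- exact: centered_continuous.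
- by move=> y y01; exact: centered_derive.
- by move=> y y01; exact: beta_weight_gt0.
- by move=> y z y0 yz z1; rewrite ltrD2r ltrN2 ltr_ln// posrE (lt_trans y0).
- by rewrite centered0 centered1.
Qed.

Lemma density_neg_ln0 a : 0 < a -> density_neg_ln a 0 = 0.
Proof. by move=> a0; rewrite /density_neg_ln powR0 ?gt_eqF// mul0r. Qed.

Lemma density_neg_ln1 a : 1 < b -> density_neg_ln a 1 = 0.
Proof.
move=> b1; rewrite /density_neg_ln subrr (powR0 (x := b - 1)) ?mulr0//.
by rewrite subr_eq0 gt_eqF.
Qed.

Lemma density_neg_lnE a x : 0 < a -> 0 < x -> density_neg_ln a x = x * w a x.
Proof. by move=> a0 x0; rewrite /beta_weight mulrA mulr_powRB1// ltW. Qed.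

Lemma density_neg_ln_gt0 a x : 0 < x < 1 -> 0 < density_neg_ln a x.
Proof. by move=> /andP[x0 x1]; rewrite mulr_gt0 ?powR_gt0 ?subr_gt0. Qed.

Lemma density_neg_ln_derive a x : 0 < x < 1 ->
  is_derive x 1 (density_neg_ln a) (w a x * r a x).
Proof.
move=> /andP[x0 x1].
have h1 := is_derive1_powR a x0.
have h2 := is_derive_powR_onem R (b - 1) x x1.
apply: is_derive_eq.
rewrite /beta_weight /neg_score /GRing.scale/=.
have -> : x `^ a = x * x `^ (a - 1).
  rewrite -[X in X * _](powRr1 (ltW x0)) -powRD ?(gt_eqF x0) ?implybT//.
  by rewrite addrC subrK.
have -> : (1 - x) `^ (b - 1) = (1 - x) * (1 - x) `^ (b - 1 - 1).
  rewrite -[X in X * _]powRr1 ?subr_ge0 ?(ltW x1)// -powRD; last first.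
    by apply/implyP => _; rewrite subr_eq0 gt_eqF.
  by congr (_ `^ _); ring.
by field; rewrite subr_eq0 gt_eqF.
Qed.

Lemma density_neg_ln_continuous_lt1 a x : 0 < a -> x < 1 ->
  {within `[0, x], continuous (density_neg_ln a)}.
Proof.
move=> a0 x1; apply: within_continuousM.
  by apply: (within01_sub _ _ _ _ _ (ltW x1) (powR_within_continuous _ _ a0)).
apply: continuous_in_subspaceT => y; rewrite inE/= in_itv/= => /andP[_ yx].
by apply: powR_onem_continuous_at; exact: le_lt_trans yx x1.
Qed.

Lemma density_neg_ln_continuous a : 0 < a -> 1 < b ->
  {within `[0, 1], continuous (density_neg_ln a)}.
Proof.
move=> a0 b1; apply: within_continuousM; first exact: powR_within_continuous.
by apply: powR_onem_within_continuous; rewrite subr_gt0.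
Qed.

(** Jensen's inequality for [neg_score], strictly concave in [- ln x] and of
    expectation 0: [B], the primitive from 0 of the weighted gap between its
    tangent at the mean and itself, is increasing.  At 1 the linear part of the
    tangent integrates to 0 and [neg_score] to the density, which vanishes
    there; what remains is the value at the mean times the total mass. *)
Lemma neg_score_at_mean_gt0 a : 0 < a -> 1 < b -> 0 < r a (expR (- mean a)).
Proof.
move=> a0 b1; set t := expR (- mean a).
have t01 : 0 < t < 1 by rewrite expR_gt0 expR_lt1 oppr_lt0 mean_gt0.
have Lt : - ln t = mean a by rewrite expRK opprK.
have /andP[t0 t1] := t01.
pose d := (b - 1) * (t / (1 - t) ^+ 2).
pose B x := r a t * moment 0 a x + d * centered a x - density_neg_ln a x.
have cB : {within `[0, 1], continuous B}.
  apply: within_continuousB; last exact: density_neg_ln_continuous.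
  apply: within_continuousD.
    by apply: (within_continuousZ _ _ _ _ (moment_continuous 0 a a0)).
  by apply: (within_continuousZ _ _ _ _ (centered_continuous a a0)).
pose dBf x := w a x * (r a t + d * (- ln x - mean a) - r a x).
have dB x : 0 < x < 1 -> is_derive x 1 B (dBf x).
  move=> x01; have h0 := moment_derive 0 a x a0 x01.
  have h1 := centered_derive a x a0 x01.
  have h2 := density_neg_ln_derive a x x01.
  apply: is_derive_eq.
  by rewrite /dBf /log_weight expr0 /GRing.scale/=; ring.
have dB0 x : 0 < x < 1 -> x != t -> 0 < dBf x.
  move=> x01 xt; rewrite mulr_gt0 ?beta_weight_gt0// subr_gt0 -Lt.
  exact: neg_score_tangent_lt.
clearbody dBf.
have Bt : B 0 < B t.
  apply: (derive_gt0_lt _ B dBf).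
  - by [].
  - by apply: within01_sub cB; [by []|exact: ltW].
  - by move=> x /andP[x0 xt]; apply: dB; rewrite x0 (lt_trans xt).
  - by move=> x /andP[x0 xt]; apply: dB0; rewrite ?x0 ?(lt_trans xt)// lt_eqF.
have B1 : B t < B 1.
  apply: (derive_gt0_lt _ B dBf).
  - by [].
  - by apply: within01_sub cB; [exact: ltW|by []].
  - by move=> x /andP[tx x1]; apply: dB; rewrite x1 (lt_trans _ tx).
  - by move=> x /andP[tx x1]; apply: dB0; rewrite ?x1 ?(lt_trans _ tx)// gt_eqF.
have := lt_trans Bt B1; rewrite /B centered0 centered1//.
rewrite density_neg_ln0// density_neg_ln1//.
by rewrite moment0 !mulr0 !addr0 !subr0 pmulr_lgt0// moment_gt0.
Qed.

End beta.

(** * Monotonicity of the Stein kernel *)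

Section beta.
Variables (R : realType) (b : R).
Hypothesis b0 : 0 < b.
Implicit Types (a c x y z t u : R) (k : nat).

Local Notation w := (fun a => beta_weight R a b).
Local Notation r := (fun a => neg_score R a b).
Local Notation A := (centered R b).
Local Notation m := (mean R b).
Local Notation g := (density_neg_ln R b).
Local Notation K := (stein_kernel R b).

(** The numerator of the derivative of the Stein kernel.  With the coefficients
    held at [x], it is the value at [x] of a function [Lam] of the endpoint that
    vanishes at 0 and, if [1 < b], also at 1; its derivative has a constant sign
    on the side of [x] that does not contain the mean.  If [b <= 1] and
    [- ln x < m a], both terms are negative. *)
Lemma stein_num_lt0 a x : 0 < a -> 0 < x < 1 ->
  (- ln x - m a) * g a x - r a x * A a x < 0.
Proof.
move=> a0 x01; have /andP[x0 x1] := x01.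
have A0 := centered_gt0 _ _ b0 _ _ a0 x01.
have g0 := density_neg_ln_gt0 _ b a _ x01.
pose Lam u := (- ln x - m a) * g a u - r a x * A a u.
pose dL u := w a u * ((- ln x - m a) * r a u - r a x * (- ln u - m a)).
have dLam u : 0 < u < 1 -> is_derive u 1 Lam (dL u).
  move=> u01; have h1 := centered_derive _ _ b0 _ _ a0 u01.
  have h2 := density_neg_ln_derive _ b a _ u01.
  by apply: is_derive_eq; rewrite /dL /GRing.scale/=; ring.
have cA := centered_continuous _ _ b0 _ a0.
have left_case : (forall u, 0 < u < x ->
    (- ln x - m a) * r a u - r a x * (- ln u - m a) < 0) -> Lam x < 0.
  move=> H; rewrite -oppr_gt0.
  have -> : 0 = - Lam 0.
    by rewrite /Lam density_neg_ln0// centered0 !mulr0 subr0 oppr0.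
  apply: (derive_gt0_lt _ (fun u => - Lam u) (fun u => - dL u) 0 x).
    by [].
  - move=> u; apply: continuousN; move: u; apply: within_continuousB.
      by apply: within_continuousZ; exact: density_neg_ln_continuous_lt1.
    by apply: within_continuousZ; apply: within01_sub cA => //; exact: ltW.
  - move=> u /andP[u0 ux]; have h : 0 < u < 1 by rewrite u0 (lt_trans ux).
    by have h1 := dLam u h; apply: is_derive_eq.
  - move=> u /andP[u0 ux]; have h : 0 < u < 1 by rewrite u0 (lt_trans ux).
    by rewrite oppr_gt0 pmulr_rlt0 ?beta_weight_gt0// H// u0.
have lnlt u v : 0 < u -> u < v -> ln u < ln v.
  by move=> u0 uv; rewrite ltr_ln ?posrE// (lt_trans u0).
(* If b <= 1, then r is positive and nondecreasing in x. *)
have [b1|b1] := lerP b 1.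
  have r0 : 0 < r a x.
    have : 0 <= (1 - b) * (x / (1 - x)).
      by rewrite mulr_ge0 ?subr_ge0// divr_ge0 ?subr_ge0 ?(ltW x0) ?(ltW x1).
    by rewrite /neg_score; lra.
  have [xm|xm] := ltrP (- ln x - m a) 0.
    rewrite subr_lt0 (@lt_trans _ _ 0)//; first by rewrite nmulr_rlt0.
    by rewrite mulr_gt0.
  apply: left_case => u /andP[u0 ux].
  have rux : r a u <= r a x.
    rewrite /neg_score lerD2l lerN2 ler_wnM2l ?subr_le0//.
    have u1' : 0 < 1 - u by rewrite subr_gt0 (lt_trans ux).
    have x1' : 0 < 1 - x by rewrite subr_gt0.
    by rewrite ler_pdivrMr// mulrAC ler_pdivlMr//; lra.
  have := lnlt _ _ u0 ux; move: r0 rux xm.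
  move: (r a u) (r a x) (ln u) (ln x) (m a) => ru rx lu lx mm r0 rux xm lux.
  nra.
(* If 1 < b, the values of r at u and at the mean lie below the tangent of
   slope d at x; in the combination used below d cancels. *)
have t0_gt := neg_score_at_mean_gt0 _ _ b0 _ a0 b1.
have m0 := mean_gt0 _ _ b0 _ a0.
set t := expR (- m a) in t0_gt.
have t01 : 0 < t < 1 by rewrite expR_gt0 expR_lt1 oppr_lt0.
have Lt : - ln t = m a by rewrite expRK opprK.
have Tt := neg_score_tangent_le _ a b x t b1 x01 t01.
have Tu u u01 := neg_score_tangent_le _ a b x u b1 x01 u01.
set d := (b - 1) * (x / (1 - x) ^+ 2) in Tt Tu.
rewrite Lt in Tt.
have [xm|xm|xm] := ltgtP (- ln x) (m a); last first.
- rewrite xm subrr mul0r sub0r oppr_lt0 mulr_gt0//.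
  suff -> : x = t by [].
  by rewrite /t -xm opprK lnK.
- apply: left_case => u /andP[u0 ux].
  have := Tu u ltac:(by rewrite u0 (lt_trans ux)).
  have := lnlt _ _ u0 ux; move: Tt t0_gt xm.
  move: (r a u) (r a x) (r a t) (ln u) (ln x) (m a) => ru rx rt lu lx mm.
  move=> Tt rt0 xm lux Tu'.
  have : 0 <= (- lx - mm) * (rx + d * (- lu - - lx) - ru).
    by rewrite mulr_ge0// subr_ge0// ltW.
  have : 0 <= (lx - lu) * (rx + d * (mm - - lx) - rt).
    by rewrite mulr_ge0// subr_ge0// ltW.
  have : 0 < (lx - lu) * rt by rewrite mulr_gt0// subr_gt0.
  by nra.
- rewrite -[X in X < _]/(Lam x).
  have -> : 0 = Lam 1.
    by rewrite /Lam density_neg_ln1// centered1// !mulr0 subr0.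
  apply: (derive_gt0_lt _ Lam dL); first by [].
  + apply: within_continuousB; apply: within_continuousZ.
      apply: within01_sub (density_neg_ln_continuous R b a a0 b1) => //.
      exact: ltW.
    by apply: within01_sub cA; [exact: ltW|].
  + by move=> u /andP[xu u1]; apply: dLam; rewrite u1 (lt_trans _ xu).
  + move=> u /andP[xu u1]; have u01 : 0 < u < 1 by rewrite u1 (lt_trans _ xu).
    rewrite mulr_gt0 ?beta_weight_gt0//.
    have := Tu u u01.
    have := lnlt _ _ x0 xu; move: Tt t0_gt xm.
    move: (r a u) (r a x) (r a t) (ln u) (ln x) (m a) => ru rx rt lu lx mm.
    move=> Tt rt0 xm lux Tu'.
    have : 0 <= (mm + lx) * (rx + d * (- lu - - lx) - ru).
      by rewrite mulr_ge0 ?subr_ge0//; lra.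
    have : 0 <= (lu - lx) * (rx + d * (mm - - lx) - rt).
      by rewrite mulr_ge0// subr_ge0// ltW.
    have : 0 < (lu - lx) * rt by rewrite mulr_gt0// subr_gt0.
    by nra.
Qed.
Lemma stein_kernel_gt0 a x : 0 < a -> 0 < x < 1 -> 0 < K a x.
Proof.
by move=> a0 x01; rewrite divr_gt0 ?centered_gt0 ?density_neg_ln_gt0.
Qed.

Lemma stein_kernel_decr a x y : 0 < a -> 0 < x -> x < y -> y < 1 ->
  K a y < K a x.
Proof.
move=> a0 x0 xy y1; rewrite -ltrN2.
pose dK z :=
  - (w a z * ((- ln z - m a) * g a z - r a z * A a z) / (g a z) ^+ 2).
have dKE z : 0 < z < 1 -> is_derive z 1 (fun z => - K a z) (dK z).
  move=> z01; have h1 := centered_derive R b b0 _ _ a0 z01.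
  have g0 : g a z != 0 by rewrite gt_eqF ?density_neg_ln_gt0.
  have h2 := is_deriveV g0 (density_neg_ln_derive R b a _ z01).
  have h3 := is_deriveN (is_deriveM h1 h2).
  by apply: (is_derive_eq h3); rewrite /dK /GRing.scale/=; field.
apply: (derive_gt0_lt _ (fun z => - K a z) dK).
- by [].
- apply: derivable_within_continuous => z; rewrite in_itv/= => /andP[xz zy].
  have z01 : 0 < z < 1 by rewrite (lt_le_trans x0 xz) (le_lt_trans zy y1).
  by have [] := dKE z z01.
- move=> z /andP[xz zy]; apply: dKE.
  by rewrite (lt_trans x0 xz) (lt_trans zy y1).
- move=> z /andP[xz zy].
  have z01 : 0 < z < 1 by rewrite (lt_trans x0 xz) (lt_trans zy y1).
  rewrite /dK oppr_gt0 pmulr_llt0 ?invr_gt0 ?exprn_gt0 ?density_neg_ln_gt0//.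
  by rewrite pmulr_rlt0 ?beta_weight_gt0// stein_num_lt0.
Qed.

(** The difference of the two kernels, multiplied by the density at [c], is
    [Phi] below; its derivative is the weight at [c] times an affine function of
    the kernel at [a], which is monotone in the endpoint. *)
Lemma stein_kernel_decr_param a c x : 0 < a -> a < c -> 0 < x < 1 ->
  K c x < K a x.
Proof.
move=> a0 ac x01; have c0 := lt_trans a0 ac; have /andP[x0 x1] := x01.
have d0 : 0 < c - a by rewrite subr_gt0.
pose Phi x := x `^ (c - a) * A a x - A c x.
pose psi x := (c - a) * K a x - (m a - m c).
have H : Phi 0 < Phi x.
  apply: (unimodal_gt_endpoint _ Phi (w c) psi 0 1).
  - apply: within_continuousB; last exact: centered_continuous.
    apply: within_continuousM; first exact: powR_within_continuous.
    exact: centered_continuous.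
  - move=> y y01; have /andP[y0 y1] := y01.
    have h1 := centered_derive R b b0 _ _ a0 y01.
    have h2 := centered_derive R b b0 _ _ c0 y01.
    have h3 := is_derive1_powR (c - a) y0.
    have h4 := is_deriveB (is_deriveM h3 h1) h2.
    apply: (is_derive_eq h4).
    rewrite /psi /stein_kernel density_neg_lnE// (beta_weight_shift R a b c)//.
    rewrite (_ : y `^ (c - a) = y * y `^ (c - a - 1)); last first.
      by rewrite mulr_powRB1// ltW.
    have wy : w a y != 0 by rewrite gt_eqF ?beta_weight_gt0.
    move: (gt_eqF y0) wy; rewrite /GRing.scale/=.
    move: (w a y) (A a y) (ln y) (y `^ _) (m a) (m c) => wy Ay ly Py ma mc.
    by move=> /negbT yN0 wyN0; field; rewrite wyN0 yN0.
  - by move=> y y01; exact: beta_weight_gt0.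
  - move=> y z y0 yz z1; rewrite /psi ltrD2r ltr_pM2l//.
    exact: stein_kernel_decr.
  - by rewrite /Phi !centered1// !centered0 !mulr0.
  - by [].
move: H; rewrite /Phi !centered0 mulr0 subr0 subr_gt0 => H.
have gE : g c x = x `^ (c - a) * g a x.
  by rewrite !density_neg_lnE// (beta_weight_shift R a b c)// mulrCA.
rewrite /stein_kernel ltr_pdivrMr ?density_neg_ln_gt0// gE mulrCA mulrC.
by rewrite divfK ?gt_eqF ?density_neg_ln_gt0// mulrC.
Qed.

End beta.

(** * Differentiation in the parameter *)

Section beta.
Variables (R : realType) (b : R).
Hypothesis b0 : 0 < b.
Implicit Types (a c e d x y z t u : R) (k : nat).

Local Notation w := (fun a => beta_weight R a b).
Local Notation M := (moment R b).

(** Pointwise, with [s = - ln t] and [z = (c - a) s], the left side is the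
    weight at [a] times [expR (- z) - 1 + z], hence at most [z ^+ 2] times the
    larger of the weights at [a] and [c], both dominated by the weight at [e].
    The bound is integrated by comparing derivatives in the endpoint, and is
    made uniform in [x] by taking the full second moment. *)
Lemma moment_expansion a c e x : 0 < e -> e <= a -> e <= c -> 0 <= x <= 1 ->
  `|M 0 c x - M 0 a x + (c - a) * M 1 a x| <= M 2 e 1 * (c - a) ^+ 2.
Proof.
move=> e0 ea ec /andP[x0 x1].
have a0 := lt_le_trans e0 ea; have c0 := lt_le_trans e0 ec.
pose f t := log_weight R 0 c b t - log_weight R 0 a b t +
  (c - a) * log_weight R 1 a b t.
pose h t := (c - a) ^+ 2 * log_weight R 2 e b t.
have fh t : 0 < t < 1 -> `|f t| <= h t.
  move=> t01; have /andP[t0 t1] := t01.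
  pose z := (c - a) * (- ln t).
  have wle d : e <= d -> w d t <= w e t.
    move=> ed; rewrite /beta_weight ler_wpM2r ?powR_ge0//.
    by apply: ger_powR; [rewrite t0 ltW|rewrite lerD2r].
  have wc : w c t = expR (- z) * w a t.
    rewrite (beta_weight_shift R a b c)//; congr (_ * _).
    by rewrite /powR gt_eqF// /z mulrN opprK.
  have -> : f t = w a t * (expR (- z) - 1 + z).
    by rewrite /f /log_weight !expr0 expr1 !mul1r wc /z; ring.
  have -> : h t = z ^+ 2 * w e t by rewrite /h /log_weight /z; ring.
  have /andP[z1 z2] := expRN_taylor2 _ z.
  have wa := ltW (beta_weight_gt0 R a b t t01).
  rewrite ger0_norm; last exact: mulr_ge0.
  apply: (le_trans (ler_wpM2l wa z2)).
  rewrite mulrCA ler_wpM2l ?sqr_ge0// maxr_pMr// mulr1 ge_max wle//=.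
  by rewrite mulrC -wc wle.
pose F t := M 0 c t - M 0 a t + (c - a) * M 1 a t.
pose H t := (c - a) ^+ 2 * M 2 e t.
have cF : {within `[0, 1], continuous F}.
  apply: within_continuousD.
    by apply: within_continuousB; exact: moment_continuous.
  by apply: within_continuousZ; exact: moment_continuous.
have cH : {within `[0, 1], continuous H}.
  by apply: within_continuousZ; exact: moment_continuous.
have dF : forall t, 0 < t < 1 -> is_derive t 1 F (f t).
  move=> t t01.
  have h1 := moment_derive R b b0 0 c t c0 t01.
  have h2 := moment_derive R b b0 0 a t a0 t01.
  have h3 := moment_derive R b b0 1 a t a0 t01.
  exact: (is_deriveD (is_deriveB h1 h2) (is_deriveZ (c - a) h3)).
have dH : forall t, 0 < t < 1 -> is_derive t 1 H (h t).
  move=> t t01; have h1 := moment_derive R b b0 2 e t e0 t01.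
  exact: (is_deriveZ ((c - a) ^+ 2) h1).
have F0 : F 0 = 0 by rewrite /F !moment0 mulr0 subrr addr0.
have H0 : H 0 = 0 by rewrite /H !moment0 mulr0.
have sub01 t : 0 < t < x -> 0 < t < 1.
  by move=> /andP[t0 tx]; rewrite t0 (lt_le_trans tx).
have F_le_H : F x <= H x.
  rewrite -subr_ge0 -[leLHS](_ : H 0 - F 0 = 0); last by rewrite F0 H0 subr0.
  apply: (derive_ge0_le _ (fun t => H t - F t) (fun t => h t - f t)).
  - by [].
  - exact: (within01_sub R _ 0 x (lexx 0) x1 (within_continuousB cH cF)).
  - by move=> t /sub01 t01; exact: (is_deriveB (dH t t01) (dF t t01)).
  - by move=> t /sub01 /fh; rewrite ler_norml subr_ge0 => /andP[].
have NF_le_H : - F x <= H x.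
  rewrite -subr_ge0 opprK -[leLHS](_ : H 0 + F 0 = 0); last first.
    by rewrite F0 H0 addr0.
  apply: (derive_ge0_le _ (fun t => H t + F t) (fun t => h t + f t)).
  - by [].
  - exact: (within01_sub R _ 0 x (lexx 0) x1 (within_continuousD cH cF)).
  - by move=> t /sub01 t01; exact: (is_deriveD (dH t t01) (dF t t01)).
  - by move=> t /sub01 /fh; rewrite ler_norml => /andP[]; lra.
apply: (@le_trans _ _ (H x)).
  by rewrite ler_norml; apply/andP; split; rewrite -/(F x); lra.
rewrite /H mulrC ler_wpM2r ?sqr_ge0//.
move: x1; rewrite le_eqVlt => /predU1P[-> //|x1].
by apply/ltW/moment_lt.
Qed.

(** The remainder of the first-order expansion in the parameter stays quadratic
    along any curve of endpoints, regular or not; this splits the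
    derivative along a curve into the two partial ones. *)
Lemma moment_derive_param (X : R -> R) a : 0 < a ->
  (\forall c \near a, 0 <= X c <= 1) ->
  is_derive a 1 (fun c => M 0 c (X c) - M 0 a (X c) + (c - a) * M 1 a (X c)) 0.
Proof.
move=> a0 nX; apply: (is_derive_quadratic _ _ _ (M 2 (a / 2) 1)).
  by rewrite !subrr mul0r addr0.
near=> c; apply: moment_expansion.
- by rewrite divr_gt0.
- by lra.
- by apply: ltW; near: c; apply: lt_nbhsr; lra.
- by near: c.
Unshelve. all: by end_near. Qed.

(** The endpoint 1 is treated apart, as the moments need not be
    differentiable there in the endpoint. *)
Lemma total_mass_derive a : 0 < a ->
  is_derive a 1 (fun c => M 0 c 1) (- M 1 a 1).
Proof.
move=> a0.
have h : is_derive a 1 (fun c => M 0 c 1 - M 0 a 1 + (c - a) * M 1 a 1) 0.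
  apply: (moment_derive_param (fun=> 1)) => //.
  by near=> c; rewrite ler01 lexx.
have h0 := is_deriveM (is_derive_shift R a a) (is_derive_cst (M 1 a 1) a 1).
have h1 := is_deriveB h (is_deriveB h0 (is_derive_cst (M 0 a 1) a 1)).
have -> : (fun c => M 0 c 1) =
  (fun c => (M 0 c 1 - M 0 a 1 + (c - a) * M 1 a 1) -
   ((c - a) * M 1 a 1 - M 0 a 1)).
  by apply/funext => c; move: (M 0 c 1) (M 0 a 1) (M 1 a 1) => u v z; ring.
by apply: (is_derive_eq h1); rewrite /GRing.scale/=; ring.
Unshelve. all: by end_near. Qed.

Lemma moment_path_derive (X : R -> R) dX a : 0 < a ->
  (\forall c \near a, 0 <= X c <= 1) -> 0 < X a < 1 -> is_derive a 1 X dX ->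
  is_derive a 1 (fun c => M 0 c (X c)) (w a (X a) * dX - M 1 a (X a)).
Proof.
move=> a0 nX Xa dXa.
have h := moment_derive_param X a a0 nX.
have h0 : is_derive (X a) 1 (M 0 a) (w a (X a)).
  apply: (is_derive_eq (moment_derive R b b0 0 a _ a0 Xa)).
  by rewrite /log_weight expr0 mul1r.
have h1 := moment_derive R b b0 1 a _ a0 Xa.
have c0 := is_derive1_comp h0 dXa.
have c1 := is_derive1_comp h1 dXa.
have l := is_deriveM (is_derive_shift R a a) c1.
have t := is_deriveD h (is_deriveB c0 l).
have -> : (fun c => M 0 c (X c)) =
  (fun c => (M 0 c (X c) - M 0 a (X c) + (c - a) * M 1 a (X c)) +
   (M 0 a (X c) - (c - a) * M 1 a (X c))).
  apply/funext => c; move: (M 0 c (X c)) (M 0 a (X c)) (M 1 a (X c)) => u v z.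
  by ring.
by apply: (is_derive_eq t); rewrite /GRing.scale/=; ring.
Qed.

End beta.

(** * Quantiles *)

Section beta.
Variables (R : realType) (b : R).
Hypothesis b0 : 0 < b.
Notation mu := (@lebesgue_measure R).
Implicit Types (a c e d x y z t u : R) (k : nat).

Local Notation w := (fun a => beta_weight R a b).
Local Notation g := (density_neg_ln R b).
Local Notation K := (stein_kernel R b).
Local Notation M := (moment R b).

Lemma incomplete_betaE a x : 0 < a -> 0 <= x <= 1 ->
  incomplete_beta a b x = (M 0 a x)%:E.
Proof.
move=> a0 /andP[x0 x1].
have fi : mu.-integrable (`[0, x]%classic : set R) (EFin \o log_weight R 0 a b).
  by apply: integrable_sub01 => //; exact: integrable_log_weight.
rewrite /moment /parameterized_integral /Rintegral fineK; last first.
  exact: integrable_fin_num.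
transitivity (\int[mu]_(t in `]0%R, x[) (log_weight R 0 a b t)%:E)%E.
  by apply: eq_integral => t _; rewrite /log_weight expr0 mul1r.
rewrite -(integral_itv_bndoo true false)//.
apply: measurable_funS (measurable_int mu fi) => //.
by apply: subset_itvW.
Qed.

(** [Q0] and [Q1] are p-quantiles at [a0] and [a1], [X] interpolates them with
    affine logarithm, and [V] is the probability below [X]. *)
Section line.
Variables (p a0 a1 Q0 Q1 : R).
Hypotheses (a0_gt0 : 0 < a0) (a01 : a0 < a1).
Hypotheses (Q0_01 : 0 < Q0 < 1) (Q1_01 : 0 < Q1 < 1).
Hypotheses (hQ0 : M 0 a0 Q0 = p * M 0 a0 1) (hQ1 : M 0 a1 Q1 = p * M 0 a1 1).

Let slope := (ln Q1 - ln Q0) / (a1 - a0).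
Let l c := ln Q0 + slope * (c - a0).
Let X c := expR (l c).
Let V c := M 0 c (X c) / M 0 c 1.

Let l0 : l a0 = ln Q0. Proof. by rewrite /l subrr mulr0 addr0. Qed.

Let l1 : l a1 = ln Q1.
Proof. by rewrite /l /slope divfK ?subr_eq0 ?gt_eqF// addrC subrK. Qed.

Let X01 c : a0 <= c <= a1 -> 0 < X c < 1.
Proof.
move=> /andP[ac ca]; rewrite expR_gt0 expR_lt1/=.
have h0 : l a0 < 0 by rewrite l0 ln_lt0.
have h1 : l a1 < 0 by rewrite l1 ln_lt0.
have [be|be] := lerP slope 0.
- by apply: le_lt_trans h0; rewrite /l lerD2l ler_wnM2l// lerD2r.
- by apply: le_lt_trans h1; rewrite /l lerD2l ler_pM2l// lerD2r.
Qed.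

Let dX c : is_derive c 1 X (slope * X c).
Proof.
have h : is_derive c 1 l slope.
  have h1 := is_deriveB (is_derive_id c (1 : R)) (is_derive_cst a0 c 1).
  have h2 := is_deriveD (is_derive_cst (ln Q0) c 1) (is_deriveZ slope h1).
  by apply: (is_derive_eq h2); rewrite /GRing.scale/=; ring.
have h1 := is_derive1_comp (is_derive_expR (l c)) h.
by apply: (is_derive_eq h1); rewrite mulrC.
Qed.

Let dV c : a0 <= c <= a1 ->
  is_derive c 1 (fun c => - V c) (g c (X c) / M 0 c 1 * (K c (X c) - slope)).
Proof.
move=> hc; have /andP[ac ca] := hc; have c0 := lt_le_trans a0_gt0 ac.
have x01 := X01 _ hc; have /andP[x0 x1] := x01.
have nX : \forall d \near c, 0 <= X d <= 1.
  have cX : X d @[d --> c] --> X c.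
    by apply/differentiable_continuous/derivable1_diffP; have [] := dX c.
  near=> d; rewrite expR_ge0/=.
  by apply/ltW; near: d; apply: (cvgr_lt _ cX).
have h1 := moment_path_derive R b b0 X _ c c0 nX x01 (dX c).
have Z0 : M 0 c 1 != 0 by rewrite gt_eqF// moment_gt0.
have h2 := @is_deriveV _ (fun d => M 0 d 1) c _ 1 Z0
  (total_mass_derive R b b0 c c0).
have h3 := is_deriveN (is_deriveM h1 h2).
apply: (is_derive_eq h3).
have g0 : w c (X c) != 0 by rewrite gt_eqF// beta_weight_gt0.
have xN0 : X c != 0 by rewrite gt_eqF.
rewrite /stein_kernel /centered /mean density_neg_lnE//= /GRing.scale/=.
move: Z0 g0 xN0; move: (M 0 c 1) (M 1 c 1) (M 0 c (X c)) (M 1 c (X c)).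
move: (w c (X c)) (X c) slope => wc xc be Z Z1 N N1 Z0 wc0 xc0.
by field; rewrite Z0 wc0 xc0.
Unshelve. all: by end_near. Qed.

Let cV : {within `[a0, a1], continuous (fun c => - V c)}.
Proof.
apply: derivable_within_continuous => c; rewrite in_itv/= => hc.
by have [] := dV c hc.
Qed.

Let V_endpoints : V a0 = p /\ V a1 = p.
Proof.
have a1_gt0 := lt_trans a0_gt0 a01.
have /andP[Q0_gt0 _] := Q0_01; have /andP[Q1_gt0 _] := Q1_01.
rewrite /V /X l0 l1 !lnK ?posrE//.
by rewrite hQ0 hQ1 !mulfK// gt_eqF// moment_gt0.
Qed.

(** By Rolle's theorem [V] has a critical point between its equal endpoint
    values, and there the slope is a value of the Stein kernel. *)
Let slope_gt0 : 0 < slope.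
Proof.
have [V0 V1] := V_endpoints.
have [||c hc] := MVT a01 (f := fun c => - V c)
    (df := fun c => g c (X c) / M 0 c 1 * (K c (X c) - slope)).
- by move=> c; rewrite in_itv/= => /andP[? ?]; apply: dV; rewrite !ltW.
- exact: cV.
move: hc; rewrite in_itv/= => /andP[ac ca].
have hc : a0 <= c <= a1 by rewrite !ltW.
have c0 := lt_trans a0_gt0 ac; have x01 := X01 _ hc.
have k0 : 0 < g c (X c) / M 0 c 1.
  by rewrite divr_gt0 ?density_neg_ln_gt0 ?moment_gt0.
rewrite V0 V1 subrr => /esym/eqP; rewrite mulf_eq0 [a1 - a0 == 0]subr_eq0.
rewrite (gt_eqF a01) orbF mulf_eq0 (gt_eqF k0)/= subr_eq0 => /eqP <-.
exact: stein_kernel_gt0.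
Qed.

(** Along the curve the endpoint [X] and the parameter increase together, so
    that the Stein kernel decreases for two reasons and [- V] is unimodal. *)
Lemma mass_below_log_segment c : a0 < c < a1 -> M 0 c (X c) < p * M 0 c 1.
Proof.
move=> hc; have /andP[ac ca] := hc; have c0 := lt_trans a0_gt0 ac.
have [V0 V1] := V_endpoints.
rewrite -ltr_pdivrMr ?moment_gt0// -/(V c) -{1}V0 -ltrN2.
apply: (unimodal_gt_endpoint _ (fun c => - V c) (fun c => g c (X c) / M 0 c 1)
  (fun c => K c (X c) - slope) a0 a1).
- exact: cV.
- by move=> d /andP[? ?]; apply: dV; rewrite !ltW.
- move=> d /andP[ad da]; have d0 := lt_trans a0_gt0 ad.
  have x01 : 0 < X d < 1 by apply: X01; rewrite !ltW.
  by apply: divr_gt0; [exact: density_neg_ln_gt0|exact: moment_gt0].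
- move=> d e ad de ea; rewrite ltrD2r.
  have d0 := lt_trans a0_gt0 ad; have e0 := lt_trans d0 de.
  have /andP[xd0 xd1] : 0 < X d < 1 by apply: X01; rewrite !ltW// (lt_trans de).
  have /andP[xe0 xe1] : 0 < X e < 1 by apply: X01; rewrite !ltW// (lt_trans ad).
  have xde : X d < X e by rewrite ltr_expR /l ltrD2l ltr_pM2l// ltrD2r.
  apply: lt_trans (stein_kernel_decr R b b0 e _ _ e0 xd0 xde xe1) _.
  by apply: stein_kernel_decr_param => //; rewrite xd0.
- by rewrite V0 V1.
- exact: hc.
Qed.

Lemma log_segment_lt_quantile c Qc : a0 < c < a1 -> 0 < Qc < 1 ->
  M 0 c Qc = p * M 0 c 1 ->
  ln Q0 + (ln Q1 - ln Q0) / (a1 - a0) * (c - a0) < ln Qc.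
Proof.
move=> hc /andP[Qc0 Qc1] hQc; have := mass_below_log_segment _ hc.
have /andP[ac ca] := hc; have c0 := lt_trans a0_gt0 ac.
have /andP[x0 x1] : 0 < X c < 1 by apply: X01; rewrite !ltW.
rewrite -hQc => MX; rewrite -ltr_expR lnK ?posrE// -/(X c).
rewrite ltNge; apply/negP; rewrite le_eqVlt => /predU1P[E|QX].
  by move: MX; rewrite E ltxx.
have XQ := moment_lt R b b0 0 c _ _ c0 (ltW Qc0) QX (ltW x1).
by have := lt_trans MX XQ; rewrite ltxx.
Qed.

End line.
End beta.

Theorem theorem1p5 (R : realType) (p b : R) (hp : 0 < p < 1) (hb : 0 < b)
    (q : R -> R) (hq : forall a : R, 0 < a -> is_beta_quantile p a b (q a)) :
  strictly_log_concave_on `]0, +oo[ q.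
Proof.
have hM a : 0 < a -> moment R b 0 a (q a) = p * moment R b 0 a 1.
  move=> a0; have [/andP[q0 q1]] := hq _ a0.
  rewrite !incomplete_betaE// ?lexx ?ler01// ?(ltW q0) ?(ltW q1)//.
  by rewrite -EFinM => -[].
have segment x y t : 0 < x -> x < y -> 0 < t < 1 ->
    t * ln (q x) + (1 - t) * ln (q y) < ln (q (t * x + (1 - t) * y)).
  move=> x0 xy /andP[t0 t1]; have y0 := lt_trans x0 xy.
  set c := t * x + (1 - t) * y.
  have cE : c - x = (1 - t) * (y - x) by rewrite /c; ring.
  have cE' : y - c = t * (y - x) by rewrite /c; ring.
  have xc : x < c by rewrite -subr_gt0 cE mulr_gt0 ?subr_gt0.
  have cy : c < y by rewrite -subr_gt0 cE' mulr_gt0 ?subr_gt0.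
  have c0 := lt_trans x0 xc.
  have xcy : x < c < y by rewrite xc.
  have h := log_segment_lt_quantile R b hb p x y (q x) (q y) x0 xy
    (hq _ x0).1 (hq _ y0).1 (hM _ x0) (hM _ y0) c (q c) xcy
    (hq _ c0).1 (hM _ c0).
  rewrite cE mulrCA divfK ?subr_eq0 ?gt_eqF// in h.
  by rewrite (le_lt_trans _ h)//; lra.
move=> x y; rewrite !in_itv/= !andbT => x0 y0 xy t t01.
have [lt_xy|lt_yx|eq_xy] := ltgtP x y; last by rewrite eq_xy eqxx in xy.
  exact: segment.
have /andP[t0 t1] := t01.
have s01 : 0 < 1 - t < 1 by rewrite subr_gt0 t1 ltrBlDr ltrDl.
have := segment y x (1 - t) y0 lt_yx s01.
by rewrite opprB addrCA subrr addr0 [_ + t * _]addrC [_ + t * x]addrC.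
Qed.
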